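(* Let $G=(S,A_1,A_2,\to,\mathit{Goal})$ be a non-mixed GLTS and let $St$ be a reduction satisfying, at every state, Conditions I, W, R, G1, G2, V and D (but not necessarily Condition S). A state $s\in S$ is winning for player $1$ in $G$ if and only if $s$ is winning for player $1$ in the reduced game $G_{St}$.
   Context: A GLTS is a tuple $G=(S,A_1,A_2,\to,\mathit{Goal})$ with $S$ a set of states, $A_1$ (player 1) and $A_2$ (player 2) finite disjoint action sets, $A=A_1\cup A_2$, $\to\subseteq S\times A\times S$ deterministic (if $(s,a,s'),(s,a,s'')\in\to$ then $s'=s''$), and $\mathit{Goal}\subseteq S$ the goal states. Write $s\xrightarrow{a}s'$ for $(s,a,s')\in\to$, and for $w=a_1\cdots a_n$, $s\xrightarrow{w}s'$ for a chain of such steps. $en_i(s)=\{a\in A_i\mid\exists s'.\,s\xrightarrow{a}s'\}$, $en(s)=en_1(s)\cup en_2(s)$. A state with $en(s)\ne\emptyset$ is a player 1 state if $en_2(s)=\emptyset$, a player 2 state if $en_1(s)=\emptyset$, and mixed otherwise; it is a deadlock if $en(s)=\emptyset$. $G$ is non-mixed if every state is a player 1 state, a player 2 state, or a deadlock. A run from $s$ is a finite or infinite state sequence $\pi_0\pi_1\cdots$ with $\pi_0=s$ and consecutive states connected by transitions; it is maximal if infinite or its last state $s'$ has $en(s')=\emptyset$. A strategy is $\sigma:S\to A_1\cup\{\bot\}$ with $\sigma(s)\in en_1(s)$ if $en_1(s)\neq\emptyset$, else $\sigma(s)=\bot$. $\mathit{Next}_\sigma(s)=en_2(s)\cup\{\sigma(s)\}$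 if $\sigma(s)\ne\bot$, else $en_2(s)$. $\sigma$ is winning at $s$ if every maximal run from $s$ in which each step from $\pi_{i-1}$ uses an action of $\mathit{Next}_\sigma(\pi_{i-1})$ visits a state of $\mathit{Goal}$; $s$ is winning (for player 1) if a winning strategy at $s$ exists. A reduction is a function $St:S\to 2^A$, with $\overline{St(s)}=A\setminus St(s)$. The reduced game $G_{St}=(S,A_1,A_2,\to_{St},\mathit{Goal})$ has $s\xrightarrow{a}_{St}s'$ iff $s\xrightarrow{a}s'$ and $a\in St(s)$ (enabled sets, strategies, runs and winning are taken w.r.t. $\to_{St}$ there). For each $s$ fix an interesting set $I(s,\mathit{Goal})\subseteq A$: whenever $s\notin\mathit{Goal}$, $s\xrightarrow{a_1\cdots a_n}s'\in\mathit{Goal}$, some $a_i\in I(s,\mathit{Goal})$. Conditions at a state $s$: (I) if $en_1(s)\ne\emptyset$ and $en_2(s)\ne\emptyset$ then $en(s)\subseteq St(s)$; (W) for all $w\in\overline{St(s)}^*$ and $a\in St(s)$, if $s\xrightarrow{wa}s'$ then $s\xrightarrow{aw}s'$; (R) $I(s,\mathit{Goal})\subseteq St(s)$; (G1) for all $w\in\overline{St(s)}^*$, if $en_2(s)=\emptyset$ and $s\xrightarrow{w}s'$ then $en_2(s')=\emptyset$; (G2) for all $w\in\overline{St(s)}^*$, if $en_1(s)=\emptyset$ and $s\xrightarrow{w}s'$ then $en_1(s')=\emptyset$; (V) if there is $w\in A_2^*$ with $s\xrightarrow{w}s'$ and $s'\in\mathit{Goal}$ then $en_2(s)\subseteq St(s)$;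 (D) if $en_2(s)\ne\emptyset$ then there is $a\in en_2(s)\cap St(s)$ such that for all $w\in\overline{St(s)}^*$ with $s\xrightarrow{w}s'$ we have $a\in en_2(s')$. (The omitted Condition S is: $en_1(s)\cap St(s)\subseteq\mathit{safe}(s)$ or $en_1(s)\subseteq St(s)$, where $\mathit{safe}(s)$ is the set of safe player 1 actions.) *)

(* Defs.v *)
From mathcomp Require Import all_boot.
From mathcomp Require Import boolp classical_sets.

Set Implicit Arguments.
Unset Strict Implicit.
Unset Printing Implicit Defensive.

Local Open Scope classical_set_scope.

(* The finite type [act] is the whole action set A = A_1 U A_2; [set] is the
   Prop-valued powerset of classical_sets. *)
Record glts := Glts {
  state : Type;
  act : finType;
  act1 : set act;
  act2 : set act;
  trans : state -> act -> state -> Prop;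
  goal : set state;
  act_cover : act1 `|` act2 = setT;
  act_disjoint : act1 `&` act2 = set0;
  trans_det : forall s a s' s'', trans s a s' -> trans s a s'' -> s' = s''
}.

Arguments trans : clear implicits.
Arguments goal : clear implicits.
Arguments act1 : clear implicits.
Arguments act2 : clear implicits.

Fixpoint steps (G : glts) (s : state G) (w : seq (act G)) (s' : state G) : Prop :=
  match w with
  | [::] => s = s'
  | a :: w' => exists2 t, trans G s a t & steps t w' s'
  end.

Definition words (T : eqType) (X : set T) : set (seq T) :=
  [set w | forall a, a \in w -> X a].

Definition en1 (G : glts) (s : state G) : set (act G) :=
  [set a | act1 G a /\ exists s', trans G s a s'].

Definition en2 (G : glts) (s : state G) : set (act G) :=
  [set a | act2 G a /\ exists s', trans G s a s'].

Definition en (G : glts) (s : state G) : set (act G) := en1 s `|` en2 s.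

Definition player1_state (G : glts) (s : state G) : Prop :=
  en s !=set0 /\ en2 s = set0.

Definition player2_state (G : glts) (s : state G) : Prop :=
  en s !=set0 /\ en1 s = set0.

Definition deadlock (G : glts) (s : state G) : Prop := en s = set0.

Definition non_mixed (G : glts) : Prop :=
  forall s : state G, [\/ player1_state s, player2_state s | deadlock s].

(* State sequences that are finite and nonempty (first state, remaining
   states) or infinite. *)
Variant stateseq (T : Type) : Type :=
  | FinSeq of T & seq T
  | InfSeq of nat -> T.

Definition state_at (T : Type) (r : stateseq T) (i : nat) : option T :=
  match r with
  | FinSeq x p => onth (x :: p) i
  | InfSeq f => Some (f i)
  end.

Definition is_run (G : glts) (s : state G) (r : stateseq (state G)) : Prop :=
  state_at r 0 = Some s /\
  forall i x y, state_at r i = Some x -> state_at r i.+1 = Some y ->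
    exists a, trans G x a y.

Definition maximal (G : glts) (r : stateseq (state G)) : Prop :=
  match r with
  | FinSeq x p => en (last x p) = set0
  | InfSeq _ => True
  end.

(* [None] encodes the value bottom. *)
Definition is_strategy (G : glts) (sigma : state G -> option (act G)) : Prop :=
  forall s,
    (en1 s !=set0 -> exists2 a, sigma s = Some a & en1 s a) /\
    (en1 s = set0 -> sigma s = None).

Definition next (G : glts) (sigma : state G -> option (act G)) (s : state G) :
    set (act G) :=
  match sigma s with
  | Some a => en2 s `|` [set a]
  | None => en2 s
  end.

Definition subject_to (G : glts) (sigma : state G -> option (act G))
    (r : stateseq (state G)) : Prop :=
  forall i x y, state_at r i = Some x -> state_at r i.+1 = Some y ->
    exists2 a, next sigma x a & trans G x a y.

Definition winning_strategy (G : glts) (sigma : state G -> option (act G))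
    (s : state G) : Prop :=
  forall r, is_run s r -> maximal r -> subject_to sigma r ->
    exists i x, state_at r i = Some x /\ goal G x.

Definition winning (G : glts) (s : state G) : Prop :=
  exists sigma, is_strategy sigma /\ winning_strategy sigma s.

Definition reduction (G : glts) : Type := state G -> set (act G).

Definition trans_red (G : glts) (St : reduction G) (s : state G) (a : act G)
    (s' : state G) : Prop := trans G s a s' /\ St s a.

Lemma trans_red_det (G : glts) (St : reduction G) s a s' s'' :
  trans_red St s a s' -> trans_red St s a s'' -> s' = s''.
Proof. by move=> [h _] [h' _]; exact: trans_det h h'. Qed.

Definition reduced (G : glts) (St : reduction G) : glts :=
  @Glts (state G) (act G) (act1 G) (act2 G) (trans_red St) (goal G)
    (act_cover G) (act_disjoint G) (@trans_red_det G St).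

Definition interesting (G : glts) (Int : state G -> set (act G)) : Prop :=
  forall s w s', ~ goal G s -> steps s w s' -> goal G s' ->
    exists2 a, a \in w & Int s a.

Section Conditions.
Variables (G : glts) (Int : state G -> set (act G)) (St : reduction G).
Implicit Type s : state G.

Definition cond_I s : Prop :=
  en1 s !=set0 -> en2 s !=set0 -> en s `<=` St s.

Definition cond_W s : Prop :=
  forall w a s', words (~` St s) w -> St s a ->
    steps s (rcons w a) s' -> steps s (a :: w) s'.

Definition cond_R s : Prop := Int s `<=` St s.

Definition cond_G1 s : Prop :=
  forall w s', words (~` St s) w -> en2 s = set0 -> steps s w s' ->
    en2 s' = set0.

Definition cond_G2 s : Prop :=
  forall w s', words (~` St s) w -> en1 s = set0 -> steps s w s' ->
    en1 s' = set0.

Definition cond_V s : Prop :=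
  (exists w s', [/\ words (act2 G) w, steps s w s' & goal G s']) ->
  en2 s `<=` St s.

Definition cond_D s : Prop :=
  en2 s !=set0 ->
  exists2 a, (en2 s `&` St s) a &
    forall w s', words (~` St s) w -> steps s w s' -> en2 s' a.

End Conditions.

(* Main.v *)
(** The winning states of a non-mixed game are those of finite rank: goal
    states have rank 0, and each further rank adds the player 1 states with one
    successor, and the player 2 states with all successors, of smaller rank.
    Finiteness of the action set keeps the ranks in [nat].

    From [G] to the reduced game, by induction on the rank.  At a player 1 state
    [s] follow a rank-decreasing play.  By R it uses an action of [St s] before
    reaching the goal, and by G1 player 1 moves up to the first such action [a];
    W moves [a] to the front.  Non-mixedness makes all states after [a] player 1
    states, so the [a]-successor of [s] has smaller rank, although [a] need not
    be safe.

    From the reduced game to [G], a player 2 state [s] needs care only if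
    some enabled action is outside [St s]; then by V player 2 cannot reach the
    goal alone.  Playing outside [St s] for ever is impossible, because the
    action provided by D stays enabled and, by W, its successors run through a
    player 2 path from a winning state, along which ranks decrease; and leaving
    by an action [b] of [St s] ends, by W, on a player 2 path from the winning
    [b]-successor of [s]. *)

Require Import Defs.
From mathcomp Require Import all_boot.
From mathcomp Require Import boolp classical_sets.

Set Implicit Arguments.
Unset Strict Implicit.
Unset Printing Implicit Defensive.

Local Open Scope classical_set_scope.

Lemma onth_traject (T : Type) (f : T -> T) (x : T) (n i : nat) :
  onth (traject f x n) i = if i < n then Some (iter i f x) else None.
Proof.
elim: n x i => [|n IHn] x [|i] //=.
by rewrite IHn ltnS -iterSr.
Qed.

(** * Transitions along words in a non-mixed game *)

Section Steps.
Variable G : glts.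
Implicit Types (s t x y : state G) (a : act G) (w : seq (act G)).

Lemma steps_rcons s w a y :
  steps s (rcons w a) y <-> exists2 x, steps s w x & trans G x a y.
Proof.
elim: w s => [|b w IHw] s /=.
  split=> [[t sat <-]|[x -> xay]]; first by exists s.
  by exists y.
split=> [[t sbt /IHw[x twx xay]]|[x [t sbt twx] xay]].
  by exists x => //; exists t.
by exists t => //; apply/IHw; exists x.
Qed.

Lemma steps_det s w x y : steps s w x -> steps s w y -> x = y.
Proof.
elim: w s => [|a w IHw] s /=; first by move=> <-.
move=> [t sat twx] [t' sat' twy].
by apply: IHw twx _; rewrite (trans_det sat sat').
Qed.

Lemma words_rcons (X : set (act G)) w a :
  words X w -> X a -> words X (rcons w a).
Proof. by move=> Xw Xa b; rewrite mem_rcons inE => /orP[/eqP->|/Xw]. Qed.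

Lemma words_cons (X : set (act G)) a w :
  words X (a :: w) -> X a /\ words X w.
Proof.
move=> Xaw; split; first by apply: Xaw; rewrite inE eqxx.
by move=> b bw; apply: Xaw; rewrite inE bw orbT.
Qed.

Lemma act12 a : act1 G a \/ act2 G a.
Proof. by have : (act1 G `|` act2 G) a by rewrite act_cover. Qed.

Hypothesis hmixed : non_mixed G.

Lemma act1_en2 s a t : act1 G a -> trans G s a t -> en2 s = set0.
Proof.
move=> a1 sat; have en1a : en1 s a by split=> //; exists t.
case: (hmixed s) => [[_ //]|[_ e]|e]; exfalso; first by rewrite e in en1a.
by have : @en G s a by [left]; rewrite e.
Qed.

Lemma act2_en1 s a t : act2 G a -> trans G s a t -> en1 s = set0.
Proof.
move=> a2 sat; have en2a : en2 s a by split=> //; exists t.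
case: (hmixed s) => [[_ e]|[_ //]|e]; exfalso; first by rewrite e in en2a.
by have : @en G s a by [right]; rewrite e.
Qed.

Lemma en1_set0_act2 s a t : en1 s = set0 -> trans G s a t -> act2 G a.
Proof.
move=> e sat; case: (act12 a) => // a1.
by have : en1 s a by [split=> //; exists t]; rewrite e.
Qed.

End Steps.

(** * Ranks *)

Fixpoint attr (G : glts) (n : nat) (s : state G) : Prop :=
  goal G s \/
  if n is m.+1 then
    (exists a t, [/\ act1 G a, trans G s a t, en2 s = set0 & attr m t]) \/
    [/\ en1 s = set0, en2 s !=set0 & forall a t, trans G s a t -> attr m t]
  else False.

Definition attracted (G : glts) (s : state G) : Prop := exists n, attr n s.

Section Attractor.
Variable G : glts.
Implicit Types (s t x y : state G) (a : act G) (w : seq (act G)).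

Lemma attrS n s : attr n s -> attr n.+1 s.
Proof.
elim: n s => [|n IHn] s [gs|]; [by left|by []|by left|].
case=> [[a [t [a1 sat e /IHn tn]]]|[e1 e2 tn]]; right.
  by left; exists a, t.
by right; split=> // a t /tn /IHn.
Qed.

Lemma attr_le m n s : m <= n -> attr m s -> attr n s.
Proof.
move=> /subnK<-; elim: (n - m) => // k IHk /IHk; exact: attrS.
Qed.

Lemma attracted_act1 s a t : act1 G a -> trans G s a t -> en2 s = set0 ->
  attracted t -> attracted s.
Proof. by move=> a1 sat e [n tn]; exists n.+1; right; left; exists a, t. Qed.

(** By determinism each action has at most one successor, hence a rank bound of its own; over the
    finite action set these bounds have a maximum. *)
Lemma attracted_act2 s : en1 s = set0 -> en2 s !=set0 ->
  (forall a t, trans G s a t -> attracted t) -> attracted s.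
Proof.
move=> e1 e2 succ.
have /choice[f fP] : forall a, exists n, forall t, trans G s a t -> attr n t.
  move=> a; case: (pselect (exists t, trans G s a t)) => [[t sat]|no].
    have [n tn] := succ _ _ sat.
    by exists n => t' /(trans_det sat) <-.
  by exists 0 => t sat; case: no; exists t.
exists (\max_a f a).+1; right; right; split=> // a t sat.
by apply: attr_le (fP _ _ sat); exact: leq_bigmax.
Qed.

Hypothesis hmixed : non_mixed G.

(** As the game is non-mixed, player 2 has no alternative along such a path, so player 1 can follow
    it at one rank per step. *)
Lemma attr_steps1 n w t y : words (act1 G) w -> steps t w y -> attr n y ->
  attr (size w + n) t.
Proof.
elim: w t => [|a w IHw] t /=; first by move=> _ ->.
move=> /words_cons[a1 w1] [u tau uwy] yn; right; left.
by exists a, u; split=> //; [exact: act1_en2 a1 tau|exact: IHw].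
Qed.

(** The negated premise of Condition V. It excludes rank 0 along player 2 moves, so every such move
    lowers the rank of an attracted state. *)
Definition goal2_free s : Prop :=
  forall w x, words (act2 G) w -> steps s w x -> ~ goal G x.

Lemma goal2_free_trans s a t : act2 G a -> trans G s a t ->
  goal2_free s -> goal2_free t.
Proof.
move=> a2 sat free w x w2 twx; apply: (free (a :: w)); last by exists t.
by move=> b; rewrite inE => /orP[/eqP->|/w2].
Qed.

Lemma goal2_free_self s : goal2_free s -> ~ goal G s.
Proof. by move=> free; apply: (free [::]). Qed.

Lemma attr_trans2 n s a t : ~ goal G s -> act2 G a -> trans G s a t ->
  attr n s -> exists2 m, n = m.+1 & attr m t.
Proof.
move=> ngs a2 sat; case: n => [[]//|n [//|[]]].
  move=> [b [u [_ _ e _]]].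
  by have : en2 s a by [split=> //; exists t]; rewrite e.
by move=> [_ _ /(_ _ _ sat)]; exists n.
Qed.

Lemma attracted_steps2 w t y : goal2_free t -> words (act2 G) w ->
  steps t w y -> attracted t -> attracted y.
Proof.
elim: w t => [|a w IHw] t free /=; first by move=> _ ->.
move=> /words_cons[a2 w2] [u tau uwy] [n tn].
apply: (IHw u) => //; first exact: goal2_free_trans a2 tau free.
by have [m _ um] := attr_trans2 (goal2_free_self free) a2 tau tn; exists m.
Qed.

(** * Winning states are the states of finite rank *)

Lemma maximal_succ (r : stateseq (state G)) i x :
  maximal r -> state_at r i = Some x -> en x !=set0 ->
  exists y, state_at r i.+1 = Some y.
Proof.
case: r => [z p|f] /=; last by move=> _ _ _; exists (f i.+1).
elim: p z i => [|y p IHp] z [|i] //=; last exact: IHp; last by exists y.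
- by move=> e [<-]; rewrite e => -[].
- by rewrite onth0n.
Qed.

Lemma attracted_winning s : attracted s -> winning s.
Proof.
(* In the third clause [attr n.+1 x] without [attr n x] says that [x] has rank exactly [n.+1], which
   [sigma] must lower. Monotonicity of [attr] makes this [n] unique. *)
have /choice[sigma sigmaP] : forall x, exists o : option (act G),
    [/\ en1 x !=set0 -> exists2 a, o = Some a & en1 x a,
        en1 x = set0 -> o = None
      & forall n, attr n.+1 x -> ~ attr n x -> forall a t, o = Some a ->
          trans G x a t -> attr n t].
  move=> x; case: (pselect (en1 x = set0)) => [e|/eqP/set0P[b en1b]].
    by exists None; split=> // -[a]; rewrite e.
  have ne : en1 x <> set0 by move=> e; rewrite e in en1b.
  case: (pselect (exists n, attr n.+1 x /\ ~ attr n x)) => [[n [xn nxn]]|no].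
    have [gx|] := xn.
      by case: nxn; case: (n) => [|?]; left.
    case=> [[a [t [a1 xat _ tn]]]|[//]].
    exists (Some a); split=> // [_|m xm nxm _ t' [<-] /(trans_det xat) <-].
      by exists a => //; split=> //; exists t.
    suff -> : m = n by [].
    apply/eqP; rewrite eqn_leq; apply/andP; split; rewrite leqNgt; apply/negP.
      by move=> lt; apply: nxm; exact: attr_le xn.
    by move=> lt; apply: nxn; exact: attr_le xm.
  exists (Some b); split=> // [_|n xn nxn]; first by exists b.
  by case: no; exists n.
move=> [n sn]; exists sigma; split=> [x|r [r0 _] mr rsigma].
  by have [p q _] := sigmaP x.
elim: n s sn 0 r0 => [|n IHn] x xn i rx.
  by case: xn => // gx; exists i, x.
case: (pselect (attr n x)) => [xn'|nxn]; first exact: IHn xn' _ rx.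
case: (xn) => [gx|xn1]; first by exists i, x.
have ex : en x !=set0.
  case: xn1 => [[a [t [a1 xat _ _]]]|[_ [a en2a] _]]; exists a; last by right.
  by left; split=> //; exists t.
have [y ry] := maximal_succ mr rx ex.
apply: (IHn y _ i.+1 ry).
have [a nexta xay] := rsigma _ _ _ rx ry.
have [_ _ sigman] := sigmaP x.
case: xn1 => [[b [t [_ _ e _]]]|[_ _ succ]]; last exact: succ xay.
move: nexta; rewrite /Defs.next; case sx: (sigma x) => [c|]; rewrite e //.
by case=> // /= ac; rewrite -ac in sx; exact: sigman sx xay.
Qed.

(** By contraposition: under any strategy, a state of infinite rank that is no deadlock has an
    allowed successor of infinite rank. Iterating gives a maximal run that misses the goal. *)
Lemma winning_attracted s : winning s -> attracted s.
Proof.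
move=> [sigma [strat win]]; apply: contrapT => nattr.
have /choice[f fP] : forall x, exists y, ~ attracted x -> en x !=set0 ->
    ~ attracted y /\ exists2 a, Defs.next sigma x a & trans G x a y.
  move=> x; case: (pselect (exists y, ~ attracted y /\
      exists2 a, Defs.next sigma x a & trans G x a y)) => [[y yP]|no].
    by exists y.
  (* A dummy value: without such a successor [x] itself would be attracted. *)
  exists x => nx ex; case: nx.
  have succ a t : Defs.next sigma x a -> trans G x a t -> attracted t.
    move=> na xat; apply: contrapT => nt; apply: no.
    by exists t; split=> //; exists a.
  case: (hmixed x) => [[_ e2]|[_ e1]|e0]; last by case: ex => a; rewrite e0.
  - have : en1 x !=set0 by case: ex => a [] //; [exists a|rewrite e2].
    move=> /(strat x).1[a sa [a1 [t xat]]].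
    apply: (attracted_act1 a1 xat e2); apply: succ xat.
    by rewrite /Defs.next sa; right.
  - apply: attracted_act2 => //.
      by case: ex => a [] //; [rewrite e1|exists a].
    move=> a t xat; apply: (succ a) => //.
    rewrite /Defs.next ((strat x).2 e1); split; last by exists t.
    exact: en1_set0_act2 xat.
pose g i := iter i f s.
have g_nattr k : (forall i, i < k -> en (g i) !=set0) -> ~ attracted (g k).
  elim: k => [//|k IHk] ek.
  have /IHk ngk : forall i, i < k -> en (g i) !=set0.
    by move=> i ik; apply: ek; exact: leq_trans ik _.
  by have [] := fP _ ngk (ek k (leqnn _)).
have g_next k : (forall i, i <= k -> en (g i) !=set0) ->
    exists2 a, Defs.next sigma (g k) a & trans G (g k) a (g k.+1).
  move=> ek; have ngk : ~ attracted (g k).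
    by apply: g_nattr => i /ltnW; exact: ek.
  by have [] := fP _ ngk (ek k (leqnn _)).
have nowin r : maximal r ->
    (forall i x, state_at r i = Some x ->
       x = g i /\ forall j, j < i -> en (g j) !=set0) ->
    state_at r 0 = Some s -> False.
  move=> mr rg r0; have rnext i x y : state_at r i = Some x ->
      state_at r i.+1 = Some y ->
      exists2 a, Defs.next sigma x a & trans G x a y.
    by move=> /rg[-> _] /rg[-> e]; exact: g_next.
  have [||i [x [/rg[-> e] gx]]] := win r _ mr.
  - by split=> // i x y rx /(rnext _ _ _ rx)[a _]; exists a.
  - exact: rnext.
  by apply: (g_nattr _ e); exists 0; left.
(* The run is the whole orbit of [f] if it meets no deadlock, and otherwise stops at the first one,
   beyond which [f] is arbitrary. *)
have [dead|live] := pselect (exists n, `[< en (g n) = set0 >]); last first.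
  apply: (nowin (InfSeq g)) => // i x [<-]; split=> // j _.
  apply/set0P/eqP => e; apply: live; exists j; exact/asboolP.
case: (ex_minnP dead) => m /asboolP em minm.
apply: (nowin (FinSeq s (traject f (f s) m))) => //=.
  by rewrite last_traject.
move=> i x; rewrite -/(traject f s m.+1) onth_traject ltnS.
case: leqP => // im [<-]; split=> // j ji.
apply/set0P/eqP => /asboolP /minm mj.
by have := leq_trans ji (leq_trans im mj); rewrite ltnn.
Qed.

Lemma winningP s : winning s <-> attracted s.
Proof. by split; [exact: winning_attracted|exact: attracted_winning]. Qed.

End Attractor.

(** * The reduced game *)

Section Reduction.
Variables (G : glts) (St : reduction G).
Hypothesis hmixed : non_mixed G.
Implicit Types (s t x y : state G) (a : act G) (w : seq (act G)).

Lemma en1_reduced s : @en1 (reduced St) s = en1 s `&` St s.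
Proof.
apply/seteqP; split=> a /= [].
  by move=> a1 [t [sat Sta]]; split=> //; split=> //; exists t.
by move=> [a1 [t sat]] Sta; split=> //; exists t.
Qed.

Lemma en2_reduced s : @en2 (reduced St) s = en2 s `&` St s.
Proof.
apply/seteqP; split=> a /= [].
  by move=> a2 [t [sat Sta]]; split=> //; split=> //; exists t.
by move=> [a2 [t sat]] Sta; split=> //; exists t.
Qed.

Lemma non_mixed_reduced : non_mixed (reduced St).
Proof.
move=> s; have [e|/eqP/set0P ne] := pselect (@en (reduced St) s = set0).
  exact: Or33 e.
case: (hmixed s) => [[_ e]|[_ e]|e].
- by apply: Or31; split=> //; rewrite en2_reduced e set0I.
- by apply: Or32; split=> //; rewrite en1_reduced e set0I.
- case: ne => a; rewrite /en en1_reduced en2_reduced => -[] [ea _].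
    by have : @en G s a by [left]; rewrite e.
  by have : @en G s a by [right]; rewrite e.
Qed.

(** * From the game to the reduced game *)

Section Preservation.
Variable Int : state G -> set (act G).
Hypotheses (hInt : interesting Int) (hW : forall s, cond_W St s)
  (hR : forall s, cond_R Int St s) (hG1 : forall s, cond_G1 St s)
  (hD : forall s, cond_D St s).

(* [x] is the state reached from [s] by the part of the rank-decreasing play
   seen so far. *)
Lemma stubborn_successor n s w x : ~ goal G s -> en2 s = set0 ->
  words (act1 G) w -> words (~` St s) w -> steps s w x -> attr n x ->
  exists a t, [/\ act1 G a, St s a, trans G s a t & attr (size w + n).-1 t].
Proof.
(* If [x] were a goal state, R would put an interesting action of [w] into [St s]. *)
move=> ngs e2; elim: n w x => [|n IHn] w x w1 wSt swx xn.
all: have ngx : ~ goal G x by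
  move=> gx; have [a /wSt nSta /hR] := hInt ngs swx gx.
  by case: xn.
case: xn => [//|[[a [y [a1 xay _ yn]]]|[_ ne2 _]]]; last first.
  by case: ne2 => a; rewrite (hG1 wSt e2 swx).
have swy : steps s (rcons w a) y by apply/steps_rcons; exists x.
have [Sta|nSta] := pselect (St s a).
  have [t sat twy] := hW wSt Sta swy.
  exists a, t; split=> //; rewrite addnS.
  exact: (attr_steps1 hmixed w1 twy).
(* The word grows by one while the rank drops by one, so the bound is unchanged. *)
have := IHn _ _ (words_rcons w1 a1) (words_rcons wSt nSta) swy yn.
by rewrite size_rcons addSnnS.
Qed.

Lemma attr_reduced n s : attr n s -> @attr (reduced St) n s.
Proof.
elim: n s => [|n IHn] s sn; first by case: sn => [gs|//]; left.
have [gs|ngs] := pselect (goal G s); first by left.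
right; case: (sn) => [//|[[_ [_ [_ _ e2 _]]]|[e1 e2 succ]]].
  have [//|//|a [t [a1 Sta sat tn]]] :=
    stubborn_successor (w := [::]) ngs e2 _ _ erefl sn.
  left; exists a, t; split=> //; last exact: IHn.
  by rewrite en2_reduced e2 set0I.
right; split.
- by rewrite en1_reduced e1 set0I.
- by have [a ? _] := hD e2; exists a; rewrite en2_reduced.
- by move=> a t [sat _]; apply: IHn; exact: succ sat.
Qed.

End Preservation.

(** * From the reduced game to the game *)

Section Reflection.
Hypotheses (hW : forall s, cond_W St s) (hV : forall s, cond_V St s)
  (hD : forall s, cond_D St s).

(* Induction on the rank of [t], the successor of [x] by the action [a] that
   Condition D keeps enabled; it bounds the play outside [St s]. *)
Lemma attracted_outside n s a w x t : goal2_free s ->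
  (forall b u, trans G s b u -> St s b -> attracted u) ->
  act2 G a -> St s a ->
  (forall v y, words (~` St s) v -> steps s v y -> en2 y a) ->
  words (act2 G) w -> words (~` St s) w -> steps s w x -> trans G x a t ->
  attr n t -> attracted x.
Proof.
move=> free succ a2 Sta aD; elim: n w x t => [|n IHn] w x t w2 wSt swx xat tn.
all: have swt : steps s (rcons w a) t by apply/steps_rcons; exists x.
all: have ngt : ~ goal G t by apply: free swt; exact: words_rcons.
  by case: tn.
have e1 := act2_en1 hmixed a2 xat.
apply: attracted_act2 => // [|b y xby]; first by exists a; split=> //; exists t.
have b2 := en1_set0_act2 e1 xby.
have swy : steps s (rcons w b) y by apply/steps_rcons; exists x.
have [Stb|nStb] := pselect (St s b).
  have [u sbu uwy] := hW wSt Stb swy.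
  apply: (attracted_steps2 _ w2 uwy); last exact: succ sbu Stb.
  exact: goal2_free_trans b2 sbu free.
have wbSt := words_rcons wSt nStb.
have [_ [t' yat']] := aD _ _ wbSt swy.
(* A commuting square: W moves [a] to the front of both [w a] and [w b a], and determinism
   identifies the states reached by [a w]. Hence [b] leads from [t] to [t'], of smaller rank. *)
have tbt' : trans G t b t'.
  have [u sau uwt] := hW wSt Sta swt.
  have : steps s (rcons (rcons w b) a) t' by apply/steps_rcons; exists y.
  move=> /(hW wbSt Sta)[u' sau' /steps_rcons[z uwz zbt']].
  by rewrite -(trans_det sau sau') in uwz; rewrite (steps_det uwt uwz).
have [m [<-] t'm] := attr_trans2 ngt b2 tbt' tn.
exact: IHn (words_rcons w2 b2) wbSt swy yat' t'm.
Qed.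

Lemma attracted_reduced n s : @attr (reduced St) n s -> attracted s.
Proof.
elim: n s => [|n IHn] s [gs|]; [by exists 0; left|by []|by exists 0; left|].
case=> [[a [t [a1 [sat _] _ /IHn tn]]]|[_ e2 succ]].
  exact: (@attracted_act1 G s a t a1 sat (act1_en2 hmixed a1 sat) tn).
have {e2} [a0 en2a0] : en2 s !=set0.
  by case: e2 => a; rewrite en2_reduced => -[? _]; exists a.
have {}succ b u : trans G s b u -> St s b -> attracted u.
  by move=> sbu Stb; apply: IHn; exact: (succ b).
have e1 : en1 s = set0.
  by case: en2a0 => a2 [t sat]; exact: (act2_en1 hmixed a2 sat).
have [all2|nall2] := pselect (en2 s `<=` St s).
  apply: attracted_act2 => // [|b u sbu]; first by exists a0.
  apply: (succ _ _ sbu); apply: all2; split; last by exists u.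
  exact: en1_set0_act2 sbu.
(* Condition V, contraposed: some player 2 move has been pruned. *)
have free : goal2_free s.
  by move=> w x w2 swx gx; apply: nall2; apply: hV; exists w, x.
have [a [[a2 [t sat]] Sta] aD] := hD (ex_intro _ _ en2a0).
have [m tm] := succ _ _ sat Sta.
by apply: (attracted_outside (w := [::]) free succ a2 Sta aD _ _ _ sat tm).
Qed.

End Reflection.
End Reduction.

Theorem theorem3p8 (G : glts) (Int : state G -> set (act G)) (St : reduction G)
    (hmixed : non_mixed G) (hInt : interesting Int)
    (hI : forall s, cond_I St s) (hW : forall s, cond_W St s)
    (hR : forall s, cond_R Int St s)
    (hG1 : forall s, cond_G1 St s) (hG2 : forall s, cond_G2 St s)
    (hV : forall s, cond_V St s) (hD : forall s, cond_D St s) :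
  forall s : state G, winning s <-> @winning (reduced St) s.
Proof.
move=> s; split.
  move=> /(winningP hmixed)[n sn]; apply/(winningP (non_mixed_reduced hmixed)).
  by exists n; exact: attr_reduced hInt hW hR hG1 hD n s sn.
move=> /(winningP (non_mixed_reduced hmixed))[n sn]; apply/(winningP hmixed).
exact: attracted_reduced sn.
Qed.
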